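(* Let $(M,g)$ be a pseudo-Riemannian manifold with Levi-Civita connection $\nabla^g$, and let $f$ be a smooth function on $M$ whose Hessian $\mathrm{Hess}(f)$ is non-degenerate and of constant signature. Then $(\mathrm{Hess}(f),\nabla^g)$ is a statistical structure on $M$ if and only if $R^{\nabla^g}(X,Y)\nabla f=0$ for all vector fields $X,Y\in\mathfrak{X}(M)$.
   Context: A statistical structure on a smooth manifold $M$ is a pair $(h,\nabla)$ where $h$ is a pseudo-Riemannian metric, $\nabla$ is a torsion-free affine connection, and $\nabla h$ is a Codazzi tensor: $(\nabla_X h)(Y,Z)=(\nabla_Y h)(X,Z)$ for all $X,Y,Z\in\mathfrak{X}(M)$. Here $\nabla f$ denotes the gradient of $f$ with respect to $g$, $\mathrm{Hess}(f)(X,Y)=g(\nabla^g_X\nabla f,Y)$, and $R^{\nabla^g}(X,Y)=\nabla^g_X\nabla^g_Y-\nabla^g_Y\nabla^g_X-\nabla^g_{[X,Y]}$ is the curvature tensor. *)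

(* Defs.v *)
From HB Require Import structures.
From mathcomp Require Import all_boot all_order all_algebra.
From mathcomp Require Import all_classical all_reals all_analysis.
From mathcomp Require Import ring.
Import Order.TTheory GRing.Theory Num.Theory.
Import numFieldNormedType.Exports.
Set Implicit Arguments.
Unset Strict Implicit.
Unset Printing Implicit Defensive.
Local Open Scope classical_set_scope.
Local Open Scope ring_scope.

Section EuclideanSmooth.
Context {R : realType} {n : nat}.
Implicit Types (U : set 'rV[R]_n) (f g : 'rV[R]_n -> R^o).

Fixpoint Ck (k : nat) U f : Prop :=
  (forall x, U x -> {for x, continuous f}) /\
  (if k is k'.+1 then
     forall i : 'I_n, (forall x, U x -> derivable f x (delta_mx 0 i)) /\
                      Ck k' U (fun x => 'D_(delta_mx 0 i) f x)
   else True).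

(* Meant for [U] open: the values of [f] near each point of [U] matter. *)
Definition smooth_on U f : Prop := forall k, Ck k U f.

Lemma Ck_ext k U f g : open U -> (forall x, U x -> f x = g x) ->
  Ck k U f -> Ck k U g.
Proof.
move=> Uo.
have near_fg f1 g1 (fg : forall x, U x -> f1 x = g1 x) x :
    U x -> \near x, f1 x = g1 x.
  by move=> Ux; apply: filterS (open_nbhs_nbhs (conj Uo Ux)).
have cont_fg f1 g1 (fg : forall x, U x -> f1 x = g1 x) x :
    U x -> {for x, continuous f1} -> {for x, continuous g1}.
  move=> Ux cf; rewrite /prop_for /continuous_at -fg//.
  by apply: cvg_trans cf; exact: (near_eq_cvg (near_fg _ _ fg x Ux)).
elim: k f g => [|k IH] f g fg [cf Df].
  by split=> // x Ux; exact: cont_fg fg _ Ux (cf x Ux).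
split=> [x Ux|i]; first exact: cont_fg fg _ Ux (cf x Ux).
have [df cD] := Df i; split=> [x Ux|].
  exact: near_eq_derivable (near_fg _ _ fg x Ux) (df x Ux).
by apply: IH cD => x Ux; exact: (near_eq_derive _ (near_fg _ _ fg x Ux)).
Qed.

Lemma CkS k U f : Ck k.+1 U f -> Ck k U f.
Proof.
elim: k f => [|k IH] f [cf Df]; first by split.
by split=> // i; have [df cD] := Df i; split=> //; exact: IH.
Qed.

Lemma Ck_cst k U (c : R) : Ck k U (cst c).
Proof.
elim: k c => [|k IH] c.
  by split=> [x _|//]; exact: cst_continuous.
split=> [x _|i]; first exact: cst_continuous.
split=> [x _|]; first exact: derivable_cst.
rewrite [X in Ck _ _ X](_ : _ = cst 0) ?funeqE//.
by move=> x; rewrite derive_cst.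
Qed.

Lemma CkD k U f g : open U -> Ck k U f -> Ck k U g -> Ck k U (f + g).
Proof.
move=> Uo; elim: k f g => [|k IH] f g [cf Df] [cg Dg].
  by split=> [x Ux|//]; exact: continuousD (cf x Ux) (cg x Ux).
split=> [x Ux|i]; first exact: continuousD (cf x Ux) (cg x Ux).
have [df cDf] := Df i; have [dg cDg] := Dg i.
split=> [x Ux|]; first exact: derivableD (df x Ux) (dg x Ux).
apply: Ck_ext (IH _ _ cDf cDg) => // x Ux.
by rewrite deriveD//; [exact: df|exact: dg].
Qed.

Lemma CkM k U f g : open U -> Ck k U f -> Ck k U g -> Ck k U (f * g).
Proof.
move=> Uo; elim: k f g => [|k IH] f g Cf Cg.
  have [cf Df] := Cf; have [cg Dg] := Cg.
  by split=> [x Ux|//]; exact: continuousM (cf x Ux) (cg x Ux).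
have [cf Df] := Cf; have [cg Dg] := Cg.
split=> [x Ux|i]; first exact: continuousM (cf x Ux) (cg x Ux).
have [df cDf] := Df i; have [dg cDg] := Dg i.
split=> [x Ux|]; first exact: derivableM (df x Ux) (dg x Ux).
apply: Ck_ext (CkD Uo (IH _ _ (CkS Cf) cDg) (IH _ _ (CkS Cg) cDf)) => // x Ux.
by rewrite deriveM//; [exact: df|exact: dg].
Qed.

End EuclideanSmooth.

Record chart (R : realType) (n : nat) (M : topologicalType) := Chart {
  dom : set M;
  coord : M -> 'rV[R]_n;
  param : 'rV[R]_n -> M;
  dom_open : open dom;
  img_open : open (coord @` dom);
  coordK : forall p, dom p -> param (coord p) = p;
  coord_continuous : forall p, dom p -> {for p, continuous coord};
  param_continuous : forall x, (coord @` dom) x -> {for x, continuous param} }.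

Arguments dom_open {R n M} _.
Arguments img_open {R n M} _.

Definition smoothly_compatible (R : realType) (n : nat) (M : topologicalType)
    (c1 c2 : chart R n M) : Prop :=
  forall i : 'I_n, smooth_on (coord c1 @` (dom c1 `&` dom c2))
    (fun x => coord c2 (param c1 x) 0 i).

(* The atlas need not be maximal: it determines the smooth structure. *)
Record smooth_manifold (R : realType) (n : nat) := SmoothManifold {
  carrier :> topologicalType;
  atlas : set (chart R n carrier);
  manifold_hausdorff : hausdorff_space carrier;
  manifold_second_countable : @second_countable carrier;
  atlas_cover : forall p : carrier, exists2 c, atlas c & dom c p;
  atlas_compatible : forall c1 c2, atlas c1 -> atlas c2 ->
    smoothly_compatible c1 c2 }.

Section SmoothFunctions.
Context {R : realType} {n : nat} (M : smooth_manifold R n).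

Definition smooth (f : M -> R^o) : Prop :=
  forall c, atlas c -> smooth_on (coord c @` dom c) (f \o param c).

Definition smooth_pred : {pred M -> R^o} := fun f => `[< smooth f >].

Lemma smooth_subring : subring_closed smooth_pred.
Proof.
split.
- by apply/asboolP => c _ k; exact: Ck_cst.
- move=> f g /asboolP sf /asboolP sg; apply/asboolP => c ac k.
  have sNg := CkM (img_open c) (Ck_cst k _ (-1)) (sg c ac k).
  have := CkD (img_open c) (sf c ac k) sNg.
  by apply: Ck_ext (img_open c) _ => x _; rewrite !fctE /= mulN1r.
- move=> f g /asboolP sf /asboolP sg; apply/asboolP => c ac k.
  exact: CkM (img_open c) (sf c ac k) (sg c ac k).
Qed.

Lemma smooth_submod : subsemimod_closed smooth_pred.
Proof.
have [_ sB sM] := smooth_subring; split; first split.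
- by apply/asboolP => c _ k; exact: Ck_cst.
- move=> f g sf sg; rewrite -[g]opprK sB// -sub0r sB//.
  by apply/asboolP => c _ k; exact: Ck_cst.
- move=> a f sf; apply: (sM (cst a) f) => //.
  by apply/asboolP => c _ k; exact: Ck_cst.
Qed.

HB.instance Definition _ :=
  GRing.isSubringClosed.Build (M -> R^o) smooth_pred smooth_subring.

Record cinf := Cinf { cinf_fun :> M -> R^o; _ : cinf_fun \in smooth_pred }.
HB.instance Definition _ := [isSub for cinf_fun].
HB.instance Definition _ := [Choice of cinf by <:].
HB.instance Definition _ :=
  GRing.SubChoice_isSubComPzRing.Build (M -> R^o) smooth_pred cinf smooth_subring.
HB.instance Definition _ :=
  GRing.SubZmodule_isSubLmodule.Build R (M -> R^o) smooth_pred cinf smooth_submod.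

End SmoothFunctions.

Section TangentVectors.
Context {R : realType} {n : nat} {M : smooth_manifold R n}.

Definition derivation_at (p : M) : {pred cinf M -> R^o} := fun v =>
  `[< (forall (a : R) (f g : cinf M), v (a *: f + g) = a * v f + v g) /\
      (forall f g : cinf M, v (f * g) = v f * g p + f p * v g) >].

Lemma derivation_submod p : subsemimod_closed (derivation_at p).
Proof.
split; first split.
- apply/asboolP; split=> [a f g|f g].
    by rewrite -[LHS]/(0 : R) -[X in _ + X]/(0 : R) -[X in a * X]/(0 : R) mulr0 addr0.
  rewrite -[LHS]/(0 : R) -[X in X * g p]/(0 : R) -[X in f p * X]/(0 : R).
  by rewrite mulr0 mul0r addr0.
- move=> v w /asboolP[vL vM] /asboolP[wL wM]; apply/asboolP; split=> *.
    by rewrite !fctE vL wL mulrDr addrACA.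
  by rewrite !fctE vM wM mulrDr mulrDl addrACA.
- move=> b v /asboolP[vL vM]; apply/asboolP; split=> [a f g|f g].
    by rewrite !fctE vL scalerDr; congr (_ + _); exact: mulrCA.
  rewrite !fctE vM scalerDr; congr (_ + _); first exact: mulrA.
  exact: mulrCA.
Qed.

Lemma derivation_zmod p : zmod_closed (derivation_at p).
Proof.
have [[v0 vD] vZ] := derivation_submod p; split=> // v w vv vw.
by rewrite -[- w]scaleN1r; apply: vD => //; exact: vZ.
Qed.

(* The tangent space T_p M, as the derivations at p of the algebra of smooth
   functions on M. *)
Record tangent (p : M) := Tangent {
  tangent_fun :> cinf M -> R^o;
  _ : tangent_fun \in derivation_at p }.

End TangentVectors.
Arguments tangent {R n M} p.

Section TangentModule.
Context {R : realType} {n : nat} {M : smooth_manifold R n} (p : M).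
HB.instance Definition _ := [isSub for @tangent_fun R n M p].
HB.instance Definition _ := [Choice of tangent p by <:].
HB.instance Definition _ := GRing.SubChoice_isSubZmodule.Build
  (cinf M -> R^o) (derivation_at p) (tangent p) (derivation_zmod p).
HB.instance Definition _ := GRing.SubZmodule_isSubLmodule.Build R
  (cinf M -> R^o) (derivation_at p) (tangent p) (derivation_submod p).

Lemma tangentP (v w : tangent p) : (forall f, v f = w f) -> v = w.
Proof. by move=> vw; apply: val_inj; apply/funext. Qed.

Lemma tangentL (v : tangent p) (a : R) (f g : cinf M) :
  v (a *: f + g) = a * v f + v g.
Proof. by case: v => v /= /asboolP[]. Qed.

Lemma tangentM (v : tangent p) (f g : cinf M) :
  v (f * g) = v f * g p + f p * v g.
Proof. by case: v => v /= /asboolP[]. Qed.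

Lemma tangentDE (v w : tangent p) f : (v + w) f = v f + w f.
Proof. by []. Qed.
Lemma tangentZE (a : R) (v : tangent p) f : (a *: v) f = a * v f.
Proof. by []. Qed.
Lemma tangentBE (v w : tangent p) f : (v - w) f = v f - w f.
Proof. by []. Qed.
Lemma tangentNE (v : tangent p) f : (- v) f = - v f.
Proof. by []. Qed.
End TangentModule.

Section VectorFields.
Context {R : realType} {n : nat} {M : smooth_manifold R n}.

Lemma cinf_smooth (f : cinf M) : smooth f.
Proof. exact/asboolP/(valP f). Qed.

Definition mk_cinf (f : M -> R^o) (sf : smooth f) : cinf M :=
  @Cinf R n M f (asboolT sf).

Lemma cinfP (f g : cinf M) : (forall p, f p = g p) -> f = g.
Proof. by move=> fg; apply: val_inj; apply/funext. Qed.

Record vfield := VField {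
  vfield_at :> forall p : M, tangent p;
  vfield_smooth : forall f : cinf M, smooth (fun p => vfield_at p f) }.

HB.instance Definition _ := gen_eqMixin vfield.
HB.instance Definition _ := gen_choiceMixin vfield.

Lemma vfieldP (X Y : vfield) : (forall p, X p = Y p) -> X = Y.
Proof.
case: X Y => [X sX] [Y sY] /= XY.
have {}XY : X = Y by exact: functional_extensionality_dep.
by subst Y; congr VField; exact: Prop_irrelevance.
Qed.

Definition lie_app (X : vfield) (f : cinf M) : cinf M :=
  mk_cinf (vfield_smooth X f).

Lemma vfield0_smooth (f : cinf M) : smooth (fun p : M => (0 : tangent p) f).
Proof. exact: (cinf_smooth 0). Qed.
Definition vfield0 := VField vfield0_smooth.

Lemma vfieldD_smooth (X Y : vfield) (f : cinf M) :
  smooth (fun p => (X p + Y p) f).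
Proof. exact: (cinf_smooth (lie_app X f + lie_app Y f)). Qed.
Definition vfieldD X Y := VField (vfieldD_smooth X Y).

Lemma vfieldN_smooth (X : vfield) (f : cinf M) : smooth (fun p => (- X p) f).
Proof. exact: (cinf_smooth (- lie_app X f)). Qed.
Definition vfieldN X := VField (vfieldN_smooth X).

Lemma vfieldZ_smooth (a : cinf M) (X : vfield) (f : cinf M) :
  smooth (fun p => (a p *: X p) f).
Proof. exact: (cinf_smooth (a * lie_app X f)). Qed.
Definition vfieldZ a X := VField (vfieldZ_smooth a X).

Lemma vfieldDA : associative vfieldD.
Proof. by move=> X Y Z; apply: vfieldP => p; exact: addrA. Qed.
Lemma vfieldDC : commutative vfieldD.
Proof. by move=> X Y; apply: vfieldP => p; exact: addrC. Qed.
Lemma vfieldD0 : left_id vfield0 vfieldD.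
Proof. by move=> X; apply: vfieldP => p; exact: add0r. Qed.
Lemma vfieldDN : left_inverse vfield0 vfieldN vfieldD.
Proof. by move=> X; apply: vfieldP => p; exact: addNr. Qed.
HB.instance Definition _ :=
  GRing.isZmodule.Build vfield vfieldDA vfieldDC vfieldD0 vfieldDN.

Lemma vfieldZA (a b : cinf M) (X : vfield) :
  vfieldZ a (vfieldZ b X) = vfieldZ (a * b) X.
Proof. by apply: vfieldP => p; exact: scalerA. Qed.
Lemma vfieldZ1 : left_id 1 vfieldZ.
Proof. by move=> X; apply: vfieldP => p; exact: scale1r. Qed.
Lemma vfieldZDr : right_distributive vfieldZ +%R.
Proof. by move=> a X Y; apply: vfieldP => p; exact: scalerDr. Qed.
Lemma vfieldZDl (X : vfield) : {morph vfieldZ^~ X : a b / a + b}.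
Proof. by move=> a b; apply: vfieldP => p; exact: scalerDl. Qed.
HB.instance Definition _ := GRing.Zmodule_isLmodule.Build (cinf M) vfield
  vfieldZA vfieldZ1 vfieldZDr vfieldZDl.

Lemma bracket_derivation (X Y : vfield) (p : M) :
  (fun f => X p (lie_app Y f) - Y p (lie_app X f)) \in derivation_at p.
Proof.
have appL Z (a : R) (f g : cinf M) :
    lie_app Z (a *: f + g) = a *: lie_app Z f + lie_app Z g.
  by apply: cinfP => q; exact: tangentL.
have appM Z (f g : cinf M) : lie_app Z (f * g) = lie_app Z f * g + f * lie_app Z g.
  by apply: cinfP => q; exact: tangentM.
apply/asboolP; split=> [a f g|f g].
  by rewrite !appL !tangentL mulrBr opprD addrACA.
have tD (v : tangent p) (h k : cinf M) : v (h + k) = v h + v k.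
  by rewrite -[h in LHS]scale1r tangentL mul1r.
rewrite !appM !tD !tangentM /=.
ring.
Qed.

Definition bracket_at (X Y : vfield) (p : M) : tangent p :=
  Tangent (bracket_derivation X Y p).

Lemma bracket_smooth (X Y : vfield) (f : cinf M) :
  smooth (fun p => bracket_at X Y p f).
Proof.
exact: (cinf_smooth (lie_app X (lie_app Y f) - lie_app Y (lie_app X f))).
Qed.

Definition bracket (X Y : vfield) : vfield := VField (bracket_smooth X Y).

End VectorFields.
Arguments vfield {R n} M.

Section Connections.
Context {R : realType} {n : nat} {M : smooth_manifold R n}.

(* Tensoriality in the direction is built in: [nabla p v Y] is the covariant
   derivative of Y along a single tangent vector v at p. *)
Record connection := Connection {
  connection_at :> forall p : M, tangent p -> vfield M -> tangent p;
  connectionL : forall (p : M) (a : R) (v w : tangent p) (Y : vfield M),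
    connection_at (a *: v + w) Y = a *: connection_at v Y + connection_at w Y;
  connectionD : forall (p : M) (v : tangent p) (Y Z : vfield M),
    connection_at v (Y + Z) = connection_at v Y + connection_at v Z;
  connection_Leibniz :
    forall (p : M) (v : tangent p) (f : cinf M) (Y : vfield M),
    connection_at v (f *: Y) = v f *: Y p + f p *: connection_at v Y;
  connection_smooth : forall (X Y : vfield M) (f : cinf M),
    smooth (fun p => connection_at (X p) Y f) }.

Definition cov (nabla : connection) (X Y : vfield M) : vfield M :=
  @VField R n M (fun p => nabla p (X p) Y) (connection_smooth nabla X Y).

Definition torsion_free (nabla : connection) : Prop :=
  forall X Y, cov nabla X Y - cov nabla Y X = bracket X Y.

Definition curvature (nabla : connection) (X Y Z : vfield M) : vfield M :=
  cov nabla X (cov nabla Y Z) - cov nabla Y (cov nabla X Z)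
  - cov nabla (bracket X Y) Z.

Record tensor02 := Tensor02 {
  tensor_at :> forall p : M, tangent p -> tangent p -> R;
  tensorLl : forall (p : M) (a : R) (u v w : tangent p),
    tensor_at (a *: u + v) w = a * tensor_at u w + tensor_at v w;
  tensorLr : forall (p : M) (a : R) (u v w : tangent p),
    tensor_at w (a *: u + v) = a * tensor_at w u + tensor_at w v;
  tensor_smooth : forall X Y : vfield M,
    smooth (fun p => tensor_at (X p) (Y p)) }.

Definition tensor_app (h : tensor02) (X Y : vfield M) : cinf M :=
  mk_cinf (tensor_smooth h X Y).

(* (nabla_X h)(Y, Z) *)
Definition cov_tensor (nabla : connection) (h : tensor02) (X Y Z : vfield M) :
    cinf M :=
  lie_app X (tensor_app h Y Z) - tensor_app h (cov nabla X Y) Z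
  - tensor_app h Y (cov nabla X Z).

Definition symmetric_tensor (h : tensor02) : Prop :=
  forall p (v w : tangent p), h p v w = h p w v.

Definition nondegenerate_tensor (h : tensor02) : Prop :=
  forall p (v : tangent p), (forall w, h p v w = 0) -> v = 0.

End Connections.
Arguments connection {R n} M.
Arguments tensor02 {R n} M.

Section Signature.
Context {R : realType} {V : lmodType R}.

Definition is_basis (m : nat) (e : 'I_m -> V) : Prop :=
  forall v, exists! c : 'rV[R]_m, v = \sum_i c 0 i *: e i.

(* Sylvester normal form with [r] plus signs, [s] minus signs, and [t] zeros
   (so [t = 0] for nondegenerate forms). *)
Definition has_signature (b : V -> V -> R) (r s : nat) : Prop :=
  exists t (e : 'I_(r + s + t) -> V), is_basis e /\
    forall i j, b (e i) (e j) =
      if i == j then (if (i < r)%N then 1 else if (i < r + s)%N then -1 else 0)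
      else 0.

End Signature.

Section PseudoRiemannian.
Context {R : realType} {n : nat} {M : smooth_manifold R n}.

Definition constant_signature (h : tensor02 M) : Prop :=
  exists r s, forall p, has_signature (h p) r s.

Definition pseudo_riemannian (h : tensor02 M) : Prop :=
  [/\ symmetric_tensor h, nondegenerate_tensor h & constant_signature h].

Definition levi_civita (g : tensor02 M) (nabla : connection M) : Prop :=
  torsion_free nabla /\ forall X Y Z, cov_tensor nabla g X Y Z = 0.

(* Determines [grad] uniquely when g is nondegenerate, since w f = df(w). *)
Definition is_gradient (g : tensor02 M) (grad : cinf M -> vfield M) : Prop :=
  forall (f : cinf M) (p : M) (w : tangent p), g p (grad f p) w = w f.

Section Hessian.
Variables (g : tensor02 M) (nabla : connection M) (V : vfield M).

Let hess_at (p : M) (v w : tangent p) : R := g p (nabla p v V) w.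

Lemma hessLl (p : M) (a : R) (u v w : tangent p) :
  hess_at (a *: u + v) w = a * hess_at u w + hess_at v w.
Proof. by rewrite /hess_at connectionL tensorLl. Qed.

Lemma hessLr (p : M) (a : R) (u v w : tangent p) :
  hess_at w (a *: u + v) = a * hess_at w u + hess_at w v.
Proof. exact: tensorLr. Qed.

Lemma hess_smooth (X Y : vfield M) : smooth (fun p => hess_at (X p) (Y p)).
Proof. exact: (tensor_smooth g (cov nabla X V) Y). Qed.

(* (v, w) |-> g (nabla_v V, w), the Hessian of f when V = grad f. *)
Definition hess_of : tensor02 M := Tensor02 hessLl hessLr hess_smooth.
End Hessian.

Definition hess (g : tensor02 M) (nabla : connection M)
    (grad : cinf M -> vfield M) (f : cinf M) : tensor02 M :=
  hess_of g nabla (grad f).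

Definition statistical_structure (h : tensor02 M) (nabla : connection M) : Prop :=
  [/\ pseudo_riemannian h, torsion_free nabla &
      forall X Y Z, cov_tensor nabla h X Y Z = cov_tensor nabla h Y X Z].

End PseudoRiemannian.

(* Main.v *)
(* With V := grad f, metric compatibility gives
   (nabla_X Hess f)(Y, Z) = g (nabla_X nabla_Y V - nabla_(nabla_X Y) V, Z), so
   by torsion-freeness the Codazzi defect of Hess f is g (R(X, Y) V, Z).  As
   g (W, grad u) = W u, a field orthogonal to all gradients vanishes.  The
   symmetry of Hess f is first obtained on pairs of vector fields; it holds for
   all pairs of tangent vectors because every tangent vector is the value of a
   gradient field: the differentials at p form a subspace of the
   finite-dimensional dual of T_p M with trivial annihilator. *)
Require Import Defs.
From HB Require Import structures.
From mathcomp Require Import all_boot all_order all_algebra.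
From mathcomp Require Import all_classical all_reals all_analysis.
From mathcomp Require Import ring.
Import Order.TTheory GRing.Theory Num.Theory.
Import numFieldNormedType.Exports.
Local Open Scope ring_scope.

(** Among the matrices whose row space lies in [S], take [A] of maximal rank; adjoining a vector of
    [S] cannot raise the rank, so [A] already spans all of [S]. *)
Lemma subspace_rowspace (F : fieldType) (m : nat) (S : 'rV[F]_m -> Prop) :
  S 0 -> (forall a x y, S x -> S y -> S (a *: x + y)) ->
  exists A : 'M[F]_m, forall x, S x <-> (x <= A)%MS.
Proof.
move=> S0 SL.
pose P r := `[< exists A : 'M[F]_m,
  (forall x, (x <= A)%MS -> S x) /\ \rank A = r >].
have exP : exists r, P r.
  exists 0%N; apply/asboolP; exists 0; split; last exact: mxrank0.
  by move=> x /submx0null ->.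
have ubP r : P r -> (r <= m)%N.
  by move=> /asboolP[A [_ <-]]; exact: rank_leq_row.
case: (ex_maxnP exP ubP) => r /asboolP[A [AS rA]] rmax.
exists A => x; split=> [Sx|]; last exact: AS.
have PAx : P (\rank (A + x)%MS).
  apply/asboolP; exists (A + x)%MS; split=> // y /sub_addsmxP[[u v] /= ->].
  (* The coefficient [v] of [x] is a 1 x 1 matrix, that is, a scalar. *)
  rewrite [v]mx11_scalar mul_scalar_mx addrC; apply: SL => //.
  exact/AS/submxMl.
have /eqmxP AAx : (A == A + x)%MS.
  by rewrite -(mxrank_leqif_eq (addsmxSl A x)) eqn_leq mxrankS ?addsmxSl// rA rmax.
by rewrite AAx addsmxSr.
Qed.

(** Each row of the kernel of [A^T] annihilates the row space of [A], which is [S]; so this kernel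
    vanishes and [A] has full rank. *)
Lemma subspace_full (F : fieldType) (m : nat) (S : 'rV[F]_m -> Prop) :
  S 0 -> (forall a x y, S x -> S y -> S (a *: x + y)) ->
  (forall u : 'rV[F]_m, (forall x, S x -> u *m x^T = 0) -> u = 0) ->
  forall x, S x.
Proof.
move=> S0 SL annS x; have [A SA] := subspace_rowspace _ _ _ S0 SL.
have kerA0 : kermx A^T = 0.
  apply/row_matrixP => i; rewrite row0; apply: annS => y /SA/submxP[D ->].
  by rewrite trmx_mul mulmxA -row_mul mulmx_ker row0 mul0mx.
apply/SA/submx_full; rewrite /row_full -mxrank_tr.
by rewrite -[_ == _]/(row_free A^T) -kermx_eq0 kerA0.
Qed.

Section Tensors.
Context {R : realType} {n : nat} {M : smooth_manifold R n}.
Variable h : tensor02 M.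

Lemma tensorBl p (u v w : tangent p) : h p (u - v) w = h p u w - h p v w.
Proof. by rewrite addrC -scaleN1r tensorLl mulN1r addrC. Qed.

Lemma tensorBr p (u v w : tangent p) : h p w (u - v) = h p w u - h p w v.
Proof. by rewrite addrC -scaleN1r tensorLr mulN1r addrC. Qed.

Lemma tensor0l p (w : tangent p) : h p 0 w = 0.
Proof. by rewrite -(subrr 0) tensorBl subrr. Qed.

Lemma tensor0r p (w : tangent p) : h p w 0 = 0.
Proof. by rewrite -(subrr 0) tensorBr subrr. Qed.

Lemma tensor_sumr p m (c : 'I_m -> R) (e : 'I_m -> tangent p) w :
  h p w (\sum_i c i *: e i) = \sum_i c i * h p w (e i).
Proof.
elim/big_rec2: _ => [|i y v _ <-]; first exact: tensor0r.
by rewrite tensorLr.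
Qed.

Lemma tangent_sum p m (c : 'I_m -> R) (e : 'I_m -> tangent p) (u : cinf M) :
  (\sum_i c i *: e i) u = \sum_i c i * e i u.
Proof. by elim/big_rec2: _ => [//|i y v _ <-]. Qed.

Lemma tangent_gradient (grad : cinf M -> vfield M) :
  pseudo_riemannian h -> is_gradient h grad ->
  forall p (v : tangent p), exists u, grad u p = v.
Proof.
move=> [_ hnd [r [s sig]]] gradP p v.
(* The signature supplies a finite basis [e] of the tangent space. *)
have [t [e [e_basis _]]] := sig p.
have span w : exists c : 'rV[R]_(r + s + t), w = \sum_i c 0 i *: e i.
  by have [c [-> _]] := e_basis w; exists c.
(* [S] consists of the differentials at [p], written in the basis dual to [e]. *)
pose S (x : 'rV[R]_(r + s + t)) :=
  exists u : cinf M, forall i, x 0 i = e i u.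
have t0 (w : tangent p) : w 0 = 0.
  have := tangentL w (-1) 0 0.
  by rewrite scaler0 addr0 mulN1r addNr.
have SL a x y : S x -> S y -> S (a *: x + y).
  move=> [u xu] [w yw]; exists (a *: u + w) => i.
  by rewrite tangentL -xu -yw !mxE.
have S0 : S 0 by exists 0 => i; rewrite mxE t0.
(* If [c] annihilates [S], then the vector with coordinates [c] kills every smooth function, so it
   is zero as a derivation. *)
have annS (c : 'rV[R]_(r + s + t)) : (forall x, S x -> c *m x^T = 0) -> c = 0.
  move=> cS.
  have ce0 : \sum_i c 0 i *: e i = 0 :> tangent p.
    apply: tangentP => u; rewrite tangent_sum.
    have := cS (\row_i e i u) (ex_intro _ u (fun i => mxE _ _ _ _)).
    move=> /matrixP/(_ 0 0); rewrite !mxE => cu0; rewrite -[RHS]cu0.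
    by apply: eq_bigr => i _; rewrite !mxE.
  have [c0 [_ uniq_c]] := e_basis 0.
  rewrite -(uniq_c c (esym ce0)); apply: uniq_c.
  by rewrite big1// => i _; rewrite mxE scale0r.
(* The functional [h p v] is therefore the differential of some [u]; nondegeneracy then identifies
   [grad u p] with [v]. *)
have [u uv] := subspace_full _ _ S S0 SL annS (\row_i h p v (e i)).
exists u; apply/eqP; rewrite -subr_eq0; apply/eqP/hnd => w.
have [c ->] := span w; rewrite tensor_sumr big1// => i _.
by rewrite tensorBl gradP -uv mxE subrr mulr0.
Qed.

End Tensors.

Section HessianOfMetric.
Context {R : realType} {n : nat} {M : smooth_manifold R n}.
Variables (g : tensor02 M) (nabla : connection M).
Hypothesis nabla_LC : levi_civita g nabla.

Lemma levi_civita_lie (X Y Z : vfield M) p :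
  X p (tensor_app g Y Z) =
  g p (nabla p (X p) Y) (Z p) + g p (Y p) (nabla p (X p) Z).
Proof.
have /(congr1 (fun u : cinf M => u p)) := nabla_LC.2 X Y Z.
rewrite -[LHS]/(X p (tensor_app g Y Z) - g p (nabla p (X p) Y) (Z p)
  - g p (Y p) (nabla p (X p) Z)) -[RHS]/(0 : R).
by move/eqP; rewrite -addrA -opprD subr_eq0 => /eqP.
Qed.

Lemma bracketE (X Y : vfield M) p :
  bracket X Y p = nabla p (X p) Y - nabla p (Y p) X.
Proof. by rewrite -nabla_LC.1. Qed.

(** Expanding X (g (nabla_Y V, Z)) by metric compatibility produces g (nabla_Y V, nabla_X Z), which
    cancels the last term of [cov_tensor]. *)
Lemma cov_hessE (V X Y Z : vfield M) p :
  cov_tensor nabla (hess_of g nabla V) X Y Z p =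
  g p (nabla p (X p) (cov nabla Y V)) (Z p)
  - g p (nabla p (nabla p (X p) Y) V) (Z p).
Proof.
rewrite -[LHS]/(X p (tensor_app (hess_of g nabla V) Y Z)
  - g p (nabla p (nabla p (X p) Y) V) (Z p)
  - g p (nabla p (Y p) V) (nabla p (X p) Z)).
have -> : tensor_app (hess_of g nabla V) Y Z = tensor_app g (cov nabla Y V) Z.
  exact: cinfP.
by rewrite levi_civita_lie /=; ring.
Qed.

Lemma connectionB p (u v : tangent p) (Y : vfield M) :
  nabla p (u - v) Y = nabla p u Y - nabla p v Y.
Proof. by rewrite addrC -scaleN1r connectionL scaleN1r addrC. Qed.

Lemma codazzi_hess (V X Y Z : vfield M) p :
  cov_tensor nabla (hess_of g nabla V) X Y Z p
  - cov_tensor nabla (hess_of g nabla V) Y X Z p =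
  g p (curvature nabla X Y V p) (Z p).
Proof.
rewrite !cov_hessE.
rewrite -[curvature nabla X Y V p]/(nabla p (X p) (cov nabla Y V)
  - nabla p (Y p) (cov nabla X V) - nabla p (bracket X Y p) V).
by rewrite bracketE connectionB !tensorBl; ring.
Qed.

Lemma hess_sym (grad : cinf M -> vfield M) (f : cinf M) :
  pseudo_riemannian g -> is_gradient g grad ->
  symmetric_tensor (hess g nabla grad f).
Proof.
move=> gm gradP p v w.
have [u <-] := tangent_gradient g _ gm gradP p v.
have [u' <-] := tangent_gradient g _ gm gradP p w.
(* Compatibility applied to Y f = g (grad f, Y). Exchanging X and Y then leaves [X, Y] f - (nabla_X
   Y - nabla_Y X) f, which is zero by torsion-freeness. *)
have hessE (X Y : vfield M) :
    hess g nabla grad f p (X p) (Y p) = X p (lie_app Y f) - nabla p (X p) Y f.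
  have -> : lie_app Y f = tensor_app g (grad f) Y.
    by apply: cinfP => q; rewrite /= gradP.
  by rewrite levi_civita_lie (gradP f p (nabla p (X p) Y)) addrK.
rewrite !hessE; apply/eqP; rewrite -subr_eq0; apply/eqP.
have := congr1 (fun z : tangent p => z f) (bracketE (grad u) (grad u') p).
rewrite tangentBE /= => brE.
have -> (a b c d : R) : a - b - (c - d) = (a - c) - (b - d) by ring.
by rewrite brE subrr.
Qed.

End HessianOfMetric.

Theorem theorem2p1 (R : realType) (n : nat) (M : smooth_manifold R n)
  (g : tensor02 M) (g_metric : pseudo_riemannian g)
  (nabla : connection M) (nabla_LC : levi_civita g nabla)
  (grad : cinf M -> vfield M) (grad_g : is_gradient g grad)
  (f : cinf M)
  (hess_nondeg : nondegenerate_tensor (hess g nabla grad f))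
  (hess_sign : constant_signature (hess g nabla grad f)) :
  statistical_structure (hess g nabla grad f) nabla <->
  (forall X Y : vfield M, curvature nabla X Y (grad f) = 0).
Proof.
have [gsym _ _] := g_metric.
split=> [[_ _ codazzi] X Y|curv0].
  apply: vfieldP => p; apply: tangentP => u.
  (* The derivative of [u] along the curvature vector is its product with [grad u], hence a Codazzi
     defect with Z = [grad u]. *)
  rewrite -(grad_g u p) gsym -codazzi_hess//.
  by rewrite -[hess_of _ _ _]/(hess g nabla grad f) codazzi subrr.
split; [split=> //; exact: hess_sym|exact: nabla_LC.1|].
move=> X Y Z; apply: cinfP => p; apply/eqP; rewrite -subr_eq0; apply/eqP.
by rewrite codazzi_hess// curv0 tensor0l.
Qed.
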